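(* Let $K\ge 6$ be an even integer and $N\ge1$. Let $a,a_1,a_2$ be integers with $0\le a_1\le\binom{K-4}{2}$, $0\le a_2\le\frac32(K-4)$, $0\le a<a_2$ and $$\binom{K-1}{2}=a+3a_1+2a_2 .$$ Then for a $(K,3,N)$ hotplug coded caching system the memory-rate point $$\left(\frac MN,R\right)=\left(\frac{\binom{K-1}{2}}{3(a_1+a_2)},\ \frac{3(a_1+a_2)-\binom{K-1}{2}}{3(a_1+a_2)}\right)$$ is achievable and optimal (it meets the cut-set bound).
   Context: Hotplug coded caching. In a $(K,K',N)$ hotplug coded caching system ($K'\le K$) a server stores $N$ files $W_1,\dots,W_N$, each of size $L$ bits (for a suitable $L$, so that files can be split and MDS-coded as needed), and is connected to $K$ users by an error-free shared link; each user has a cache of size $M$ files ($ML$ bits). In the placement phase the server fills the caches with functions of the files, knowing $K'$ but neither the identity of the $K'$ users who will be active nor the demands. In the delivery phase an arbitrary set $I\subseteq\{1,\dots,K\}$, $|I|=K'$, of active users reveals arbitrary demands $(d_i)_{i\in I}\in\{1,\dots,N\}^{I}$; the server broadcasts a message of size $RL$ bits, depending on the files, $I$ and the demands, such that each active user $i$ recovers $W_{d_i}$ from the message and its own cache. $R$ is the rate. The scheme must work for all files, all $I$ and all demands. A pair $(M/N,R)$ is achievable if such a scheme exists. Cut-set bound: every scheme with cache size $0\le M\le N$ has rate $R\ge\max_{s\in\{1,\dots,\min\{N,K'\}\}}\left(s-\frac{s}{\lfloor N/s\rfloor}M\right)$. A point is optimal if it is achievable and no scheme with the same $M$ has smaller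 rate; here it meets the cut-set bound in that $R=1-\frac MN$ (the term $s=1$). *)

(* Defs.v *)
From mathcomp Require Import all_boot all_order all_algebra.

Set Implicit Arguments.
Unset Strict Implicit.
Unset Printing Implicit Defensive.

Import Order.TTheory GRing.Theory Num.Theory.

Definition bits (n : nat) := n.-tuple bool.

Definition library (N L : nat) := {ffun 'I_N -> bits L}.

Definition demands (K N : nat) (I : {set 'I_K}) := {i | i \in I} -> 'I_N.

(* [C] and [D] are the cache and message sizes in bits.  The placement sees
   neither the active set nor the demands.  The active set and the demand vector
   are public during delivery (they are not counted in the message), hence are
   available to the decoders.  [message] and [decode] are total in [I], but only
   active sets of size [K'] are constrained. *)
Record scheme (K K' N L C D : nat) := Scheme {
  cache : 'I_K -> library N L -> bits C;
  message : forall I : {set 'I_K}, demands N I -> library N L -> bits D;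
  decode : forall I : {set 'I_K},
    demands N I -> {i | i \in I} -> bits D -> bits C -> bits L;
  decodeP : forall (I : {set 'I_K}) (d : demands N I) (i : {i | i \in I})
      (W : library N L), #|I| = K' ->
    decode d i (message d W) (cache (val i) W) = W (d i)
}.

Local Open Scope ring_scope.

(* [x] is the normalized cache size M / N; a point realized by a scheme is
   rational because L, M L and R L are numbers of bits. *)
Definition achievable (K K' N : nat) (x r : rat) : Prop :=
  exists L C D : nat,
    [/\ (0 < L)%N, C%:R = (N%:R * x) * L%:R, D%:R = r * L%:R
      & inhabited (scheme K K' N L C D)].

Definition optimal (K K' N : nat) (x r : rat) : Prop :=
  achievable K K' N x r /\
  (forall r' : rat, achievable K K' N x r' -> r <= r').

Definition cutset_term (N : nat) (M : rat) (s : nat) : rat :=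
  s%:R - s%:R / (N %/ s)%:R * M.

(* The default value of the maximum is the term s = 1, which belongs to the
   range as soon as N and K' are positive. *)
Definition cutset_bound (K' N : nat) (M : rat) : rat :=
  \big[Num.max/cutset_term N M 1]_(1 <= s < (minn N K').+1) cutset_term N M s.

(* Main.v *)
Require Import Defs.
From mathcomp Require Import all_boot all_order all_algebra all_field.
From mathcomp Require Import zify ring lra.

Set Implicit Arguments.
Unset Strict Implicit.
Unset Printing Implicit Defensive.

Import Order.TTheory GRing.Theory Num.Theory.
Local Open Scope ring_scope.

(* Achievability.  Reed-Solomon code every file into symbols indexed by the
   4-subsets of users, each subset being used m = 'C(K - 1, 2) times, and let
   user k cache the symbols whose subset contains k.  For active users i, j, k
   the server sends sums of three symbols: one of W_{d_i} whose subset contains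
   j and k but not i, and symmetrically.  User i cancels the two terms lying in
   its cache, so every transmission brings it one new symbol of W_{d_i}.  With
   b = 'C(K - 1, 3), a user caches b m symbols per file and up to
   'C(K - 3, 2) m transmissions are available.  Sending S = b (a2 - a) of them
   yields the required point, since 'C(K - 1, 2) + (a2 - a) = 3 (a1 + a2), and
   2 a2 <= 3 (K - 4) is exactly what makes S available.

   Optimality.  The cache of one user and the messages for its N constant
   demands determine the library, so N <= M + N R, that is R >= 1 - M / N.  As
   M / N >= 1 / 2, the other cut-set terms are not larger than this one. *)

(** * Linear schemes from incidence structures *)

Lemma card_le_injection (T U : finType) :
  (#|T| <= #|U|)%N -> exists f : T -> U, injective f.
Proof.
move=> le_TU; exists (fun t => enum_val (widen_ord le_TU (enum_rank t))).
by move=> s t /enum_val_inj /(congr1 val) /= /val_inj /enum_rank_inj.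
Qed.

Lemma card_bits (n : nat) : #|{: bits n}| = (2 ^ n)%N.
Proof. by rewrite card_tuple card_bool. Qed.

Lemma scheme_of_determined (K K' N L C D : nat)
    (c : 'I_K -> library N L -> bits C)
    (m : forall I : {set 'I_K}, demands N I -> library N L -> bits D) :
  (forall (I : {set 'I_K}) (d : demands N I) (i : {i | i \in I})
      (W W' : library N L), #|I| = K' ->
    m I d W = m I d W' -> c (val i) W = c (val i) W' -> W (d i) = W' (d i)) ->
  inhabited (scheme K K' N L C D).
Proof.
move=> det.
pose dec (I : {set 'I_K}) (d : demands N I) (i : {i | i \in I})
    (x : bits D) (y : bits C) : bits L :=
  if [pick W | (m I d W == x) && (c (val i) W == y)] is Some W
  then W (d i) else [tuple of nseq L false].
apply: inhabits; apply: (@Scheme _ _ _ _ _ _ c m dec) => I d i W cardI.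
rewrite /dec; case: pickP => [W' /andP[/eqP eqm /eqP eqc]|/(_ W)].
  exact: det eqm eqc.
by rewrite !eqxx.
Qed.

Lemma poly_eq_of_agree (R : idomainType) (p q : {poly R}) (s : seq R) :
  uniq s -> (size p <= size s)%N -> (size q <= size s)%N ->
  {in s, forall x, p.[x] = q.[x]} -> p = q.
Proof.
move=> s_uniq le_p le_q eq_pq; apply/eqP; rewrite -subr_eq0; apply/negPn/negP.
move=> /max_poly_roots/(_ _ s_uniq).
have -> : all (root (p - q)) s.
  by apply/allP => x /eq_pq eqx; rewrite rootE hornerD hornerN eqx subrr.
move=> /(_ isT); rewrite ltnNge (leq_trans (size_polyD _ _)) //.
by rewrite size_polyN geq_max le_p.
Qed.

(* Each file is a polynomial of size at most [B + S] over a field with [2 ^ n]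
   elements, and its coded symbols are its values at points indexed by [E]. *)
Lemma scheme_of_incidence (K K' N B S n : nat) (E : finType)
    (P : 'I_K -> {set E}) :
  (0 < n)%N -> (#|E| <= 2 ^ n)%N -> (forall k, #|P k| = B) ->
  (forall (I : {set 'I_K}) (i : 'I_K), #|I| = K' -> i \in I ->
    (S <= #|(\bigcap_(j in I :\ i) P j) :\: P i|)%N) ->
  inhabited (scheme K K' N ((B + S) * n) (N * B * n) (S * n)).
Proof.
move=> n_gt0 leE cardP leQ.
have [F _ cardF] := pPrimePowerField (isT : prime 2) n_gt0.
have [pt pt_inj] : exists f : E -> F, injective f.
  by apply: card_le_injection; rewrite cardF.
(* As [F] has [2 ^ n] elements, [g], [hc] and [hm] each map between types of equal cardinality: a
   symbol costs exactly [n] bits. *)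
have [g g_inj] : exists f : bits ((B + S) * n) -> 'rV[F]_(B + S), injective f.
  by apply: card_le_injection; rewrite card_bits card_mx mul1n cardF -expnM mulnC.
have [hc hc_inj] : exists f : {ffun 'I_N * 'I_B -> F} -> bits (N * B * n),
    injective f.
  apply: card_le_injection.
  by rewrite card_bits card_ffun card_prod !card_ord cardF -expnM mulnC.
have [hm hm_inj] : exists f : {ffun 'I_S -> F} -> bits (S * n), injective f.
  apply: card_le_injection.
  by rewrite card_bits card_ffun card_ord cardF -expnM mulnC.
pose code w e := (rVpoly (g w)).[pt e].
pose Q (I : {set 'I_K}) i := (\bigcap_(j in I :\ i) P j) :\: P i.
pose c k (W : library N ((B + S) * n)) := hc [ffun x : 'I_N * 'I_B =>
  [seq code (W x.1) e | e <- enum (P k)]`_x.2].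
pose m (I : {set 'I_K}) (d : demands N I) (W : library N ((B + S) * n)) :=
  hm [ffun s : 'I_S =>
    \sum_u [seq code (W (d u)) e | e <- enum (Q I (val u))]`_s].
apply: (@scheme_of_determined _ _ _ _ _ _ c m).
move=> I d i W W' cardI /hm_inj/ffunP eqm /hc_inj/ffunP eqc.
have cached f e : e \in P (val i) -> code (W f) e = code (W' f) e.
  move=> Pe; have lt_e : (index e (enum (P (val i))) < B)%N.
    by rewrite -(cardP (val i)) cardE index_mem mem_enum.
  have := eqc (f, Ordinal lt_e); rewrite !ffunE /=.
  by rewrite !(nth_map e) ?nth_index ?index_mem ?mem_enum.
have le_SQ u : u \in I -> (S <= #|Q I u|)%N by exact: leQ.
have le_SQi := le_SQ _ (valP i).
set sQ := take S (enum (Q I (val i))).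
have size_sQ : size sQ = S by rewrite size_take_min -cardE (minn_idPl le_SQi).
have sent e : e \in sQ -> code (W (d i)) e = code (W' (d i)) e.
  move=> Qe; have lt_s : (index e sQ < S)%N by rewrite -[ltnRHS]size_sQ index_mem.
  have nth_s : nth e (enum (Q I (val i))) (index e sQ) = e.
    by rewrite -(nth_take _ lt_s) nth_index.
  have := eqm (Ordinal lt_s); rewrite !ffunE (bigD1 i) //= [RHS](bigD1 i) //=.
  rewrite !(nth_map e) -?cardE ?(leq_trans lt_s) // nth_s.
  (* For [u != i], the set [Q I u] lies inside [P i], so user [i] has these terms cached. *)
  have -> : \sum_(u | u != i)
        [seq code (W (d u)) e0 | e0 <- enum (Q I (val u))]`_(index e sQ)
      = \sum_(u | u != i)
        [seq code (W' (d u)) e0 | e0 <- enum (Q I (val u))]`_(index e sQ).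
    apply: eq_bigr => u neq_ui.
    have lt_u : (index e sQ < size (enum (Q I (val u))))%N.
      by rewrite -cardE (leq_trans lt_s) // le_SQ // (valP u).
    rewrite !(nth_map e) //; apply: cached.
    have := mem_nth e lt_u; rewrite mem_enum => /setDP[/bigcapP + _]; apply.
    by rewrite in_setD1 (valP i) andbT eq_sym.
  exact: addIr.
(* The [B] cached and [S] received evaluation points are distinct, enough to fix a polynomial of
   size at most [B + S]. *)
apply/g_inj/(can_inj rVpolyK).
have eP_Q e : e \in sQ -> e \notin P (val i).
  by move/mem_take; rewrite mem_enum => /setDP[].
have size_s : size (map pt (enum (P (val i)) ++ sQ)) = (B + S)%N.
  by rewrite size_map size_cat size_sQ -cardE cardP.
apply: (@poly_eq_of_agree _ _ _ (map pt (enum (P (val i)) ++ sQ))).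
- rewrite map_inj_uniq // cat_uniq enum_uniq take_uniq ?enum_uniq // andbT.
  by apply/hasPn => e /eP_Q; rewrite mem_enum.
- by rewrite size_s size_poly.
- by rewrite size_s size_poly.
move=> _ /mapP[e + ->]; rewrite mem_cat mem_enum.
by move=> /orP[]; [exact: cached | exact: sent].
Qed.

(** * Incidence by subsets of users *)

Lemma card_subsets_with (T : finType) (x : T) (t : nat) :
  #|[set A : {set T} | (x \in A) && (#|A| == t.+1)]| = 'C(#|T|.-1, t).
Proof.
have := card_draws T t.+1; rewrite -(cardsID [set A : {set T} | x \in A]).
have -> : [set A : {set T} | #|A| == t.+1] :\: [set A : {set T} | x \in A]
    = [set A : {set T} | A \subset [set~ x] & #|A| == t.+1].
  by apply/setP => A; rewrite !inE subsetC sub1set inE.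
rewrite cards_draws cardsC1 -[in X in _ = X -> _](@prednK #|T|); last first.
  by apply/card_gt0P; exists x.
rewrite binS addnC => /addnI <-.
by apply: eq_card => A; rewrite !inE andbC.
Qed.

(** Adjoining [I :\ x] to a [t]-subset of the complement of [I] is injective, since removing [I]
    undoes it. *)
Lemma card_subsets_separating (T : finType) (I : {set T}) (x : T) (t : nat) :
  x \in I ->
  ('C(#|T| - #|I|, t) <=
   #|[set A : {set T} |
       [&& I :\ x \subset A, x \notin A & #|A| == (#|I|.-1 + t)%N]]|)%N.
Proof.
move=> Ix; have <- : #|~: I| = (#|T| - #|I|)%N by rewrite cardsCs setCK.
rewrite -cards_draws.
rewrite -(@card_in_imset _ _ (fun A => A :|: I :\ x)).
  apply/subset_leq_card/subsetP => _ /imsetP[A + ->].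
  rewrite inE => /andP[AI /eqP cardA]; rewrite !inE subsetUr eqxx /= orbF.
  have xA : x \notin A by apply/negP => /(subsetP AI); rewrite inE Ix.
  have -> : #|A :|: I :\ x| = (#|A| + #|I :\ x|)%N.
    rewrite cardsU disjoint_setI0 ?cards0 ?subn0 // disjoints_subset.
    by rewrite (subset_trans AI) // setCS subsetDl.
  by rewrite xA cardA addnC (cardsD1 x I) Ix add1n eqxx.
move=> A A'; rewrite !inE => /andP[AI _] /andP[AI' _] eqA.
have keep (X : {set T}) : X \subset ~: I -> (X :|: I :\ x) :\: I = X.
  move=> XI; rewrite setDUl (_ : (I :\ x) :\: I = set0).
    by rewrite setU0; apply/setDidPl; rewrite disjoints_subset.
  by apply/setP => y; rewrite !inE; case: (y \in I); rewrite ?andbF.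
by rewrite -(keep A AI) eqA keep.
Qed.

Lemma scheme_of_subsets (K K' N B S t m n : nat) :
  (0 < n)%N -> (2 ^ K * m <= 2 ^ n)%N ->
  (B = 'C(K.-1, K'.-1 + t) * m)%N -> (S <= 'C(K - K', t.+1) * m)%N ->
  inhabited (scheme K K' N ((B + S) * n) (N * B * n) (S * n)).
Proof.
move=> n_gt0 len -> leS.
(* The second coordinate numbers the [m] copies of each subset. *)
pose P (k : 'I_K) :=
  setX [set A : {set 'I_K} | (k \in A) && (#|A| == (K'.-1 + t).+1)] [set: 'I_m].
apply: (@scheme_of_incidence _ _ _ _ _ _ _ P) => //.
- by rewrite card_prod -cardsT -powersetT card_powerset cardsT !card_ord.
- by move=> k; rewrite cardsX card_subsets_with cardsT !card_ord.
move=> I i cardI Ii; apply: leq_trans leS _.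
have := card_subsets_separating t.+1 Ii; rewrite card_ord cardI.
move=> /(leq_mul (leqnn m)); rewrite mulnC => /leq_trans; apply.
rewrite mulnC -[m in leqLHS]card_ord -cardsT -cardsX.
apply/subset_leq_card/subsetP => -[A c]; rewrite !inE /= andbT.
move=> /and3P[IA iA cardA]; rewrite (negPf iA) /=.
apply/bigcapP => j Ij; rewrite !inE (subsetP IA) //= (eqP cardA) andbT.
by rewrite addnS.
Qed.

(** * Converse and cut-set bound *)

Lemma rate_ge_one_sub_memory (K K' N : nat) (x r : rat) :
  (0 < K' <= K)%N -> (0 < N)%N -> achievable K K' N x r -> 1 - x <= r.
Proof.
move=> /andP[K'_gt0 le_K'K] N_gt0 [L [C [D [L_gt0 eC eD [s]]]]].
have [I cardI] : exists I : {set 'I_K}, #|I| = K'.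
  have : (0 < #|[set A : {set 'I_K} | #|A| == K']|)%N.
    by rewrite card_draws card_ord bin_gt0.
  by move/card_gt0P => [I]; rewrite inE => /eqP; exists I.
have /card_gt0P [i Ii] : (0 < #|I|)%N by rewrite cardI.
pose all_for f : demands N I := fun=> f.
pose view W := (cache s i W, [ffun f => message s (all_for f) W]).
have view_inj : injective view.
  move=> W W' [eqc /ffunP eqm]; apply/ffunP => f.
  have := eqm f; rewrite !ffunE => eqmf.
  rewrite -[RHS](decodeP s (all_for f) (exist _ i Ii) W' cardI) /=.
  by rewrite -eqmf -eqc (decodeP s (all_for f) (exist _ i Ii) W cardI).
have := leq_card _ view_inj.
rewrite card_prod !card_ffun !card_bits card_ord -!expnM -expnD leq_exp2l //.
rewrite -(ler_nat rat) natrD !natrM eC eD => le_NL.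
have L0 : 0 < L%:R :> rat by rewrite ltr0n.
have N0 : 0 < N%:R :> rat by rewrite ltr0n.
have NL0 : 0 < N%:R * L%:R :> rat by exact: mulr_gt0.
by rewrite -(ler_pM2r NL0); lra.
Qed.

(** Bounding the floor by [N / s] makes the term at most [s - s^2 x], and [1 - x] exceeds this by
    [(s - 1) ((s + 1) x - 1)], nonnegative for [x >= 1/2]. *)
Lemma cutset_term_le (N s : nat) (x : rat) :
  (0 < s <= N)%N -> 2^-1 <= x -> cutset_term N (N%:R * x) s <= 1 - x.
Proof.
move=> /andP[s_gt0 le_sN] le_x; rewrite /cutset_term.
have q_gt0 : (0 < N %/ s)%N by rewrite divn_gt0.
have s_ge1 : 1 <= s%:R :> rat by rewrite ler1n.
have le_s : s%:R <= N%:R / (N %/ s)%:R :> rat.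
  by rewrite ler_pdivlMr ?ltr0n // -natrM ler_nat mulnC leq_trunc_div.
have : s%:R * (s%:R * x) <= s%:R * (N%:R / (N %/ s)%:R * x).
  by rewrite ler_pM2l ?ler_pM2r //; lra.
rewrite (_ : s%:R / _ * _ = s%:R * (N%:R / (N %/ s)%:R * x)); last by ring.
move: (_ * (_ / _ * x)) => z le_z.
have : 0 <= (s%:R - 1) * ((s%:R + 1) * x - 1) :> rat by apply: mulr_ge0; nra.
lra.
Qed.

Lemma cutset_bound_first_term (K' N : nat) (x : rat) :
  (0 < N)%N -> 2^-1 <= x -> cutset_bound K' N (N%:R * x) = 1 - x.
Proof.
move=> N_gt0 le_x.
have term1 : cutset_term N (N%:R * x) 1 = 1 - x.
  by rewrite /cutset_term divn1 mul1r mulKf // pnatr_eq0 -lt0n.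
rewrite /cutset_bound term1 big_nat.
apply/eqP; rewrite eq_le; apply/andP; split.
  elim/big_ind: _ => // [y z ley lez|s /andP[s_gt0]]; first by rewrite ge_max ley.
  rewrite ltnS leq_min => /andP[le_sN _]; apply: cutset_term_le => //.
  by rewrite s_gt0.
by elim/big_rec: _ => // s y _ ley; rewrite le_max ley orbT.
Qed.

Theorem theorem7 (K N a a1 a2 : nat)
    (hK : (6 <= K)%N) (hKeven : ~~ odd K) (hN : (1 <= N)%N)
    (ha1 : (a1 <= 'C(K - 4, 2))%N)
    (ha2 : a2%:R <= 3 / 2 * (K%:R - 4) :> rat)
    (ha : (a < a2)%N)
    (hsum : ('C(K - 1, 2) = a + 3 * a1 + 2 * a2)%N) :
  let B : rat := 'C(K - 1, 2)%:R in
  let F : rat := 3 * (a1%:R + a2%:R) in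
  let x : rat := B / F in
  let r : rat := (F - B) / F in
  [/\ achievable K 3 N x r,
      optimal K 3 N x r,
      r = cutset_bound 3 N (N%:R * x)
    & r = 1 - x].
Proof.
move=> B F x r.
have F_gt0 : 0 < F.
  by rewrite /F -natrD -natrM ltr0n; lia.
have eF : F = B + (a2 - a)%:R.
  rewrite /F /B hsum natrB ?(ltnW ha) //; rewrite 2!natrD 2!natrM; ring.
have er : r = 1 - x by rewrite /r /x; field; rewrite gt_eqF.
have a2_le : (2 * a2 <= 3 * (K - 4))%N.
  rewrite -(ler_nat rat) !natrM natrB; last by lia.
  lra.
have le_SB : (a2 - a <= 'C(K - 1, 2))%N by lia.
have ach : achievable K 3 N x r.
  pose b := 'C(K - 1, 3); pose m := 'C(K - 1, 2).
  (* Large enough for the field: [2 ^ K * m <= 2 ^ (K + m)] because [m < 2 ^ m]. *)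
  pose n := (K + m)%N.
  have b_gt0 : (0 < b)%N by rewrite bin_gt0; lia.
  exists ((b * m + b * (a2 - a)) * n)%N, (N * (b * m) * n)%N,
    (b * (a2 - a) * n)%N.
  have b0 : b%:R != 0 :> rat by rewrite pnatr_eq0 -lt0n.
  split.
  - by rewrite !muln_gt0 addn_gt0 !muln_gt0 b_gt0 /= bin_gt0; lia.
  - rewrite !(natrM, natrD) -/B /x eF -/m -/B; field.
    by rewrite -eF gt_eqF.
  - rewrite !(natrM, natrD) -/B /r eF -/m -/B; field.
    by rewrite -eF gt_eqF.
  apply: (@scheme_of_subsets K 3 N _ _ 1 m n).
  - by rewrite /n; lia.
  - by rewrite /n expnD leq_mul2l ltnW ?orbT // ltn_expl.
  - by rewrite /b subn1.
  (* With [3 b = (K - 3) m] and ['C(K - 3, 2) = (K - 3) (K - 4) / 2], the bound on [S] reduces to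
     [2 (a2 - a) <= 3 (K - 4)]. *)
  have e3 := mul_bin_left (K - 1) 2.
  have e2 : ('C(K - 3, 2) * 2 = (K - 3) * (K - 4))%N.
    by rewrite mulnC mul_bin_left bin1; lia.
  rewrite -/b -/m in e3.
  nia.
(* Here [F = B + (a2 - a) <= 2 B]. *)
have half_le : 2^-1 <= x.
  rewrite /x ler_pdivlMr // eF.
  have : (a2 - a)%:R <= B by rewrite ler_nat.
  lra.
split=> //; last by rewrite er cutset_bound_first_term.
split=> // r'; rewrite er; apply: rate_ge_one_sub_memory => //; lia.
Qed.
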